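(* Let $\mathcal{H}$ be a real Hilbert space and $f,g\in\Gamma_0(\mathcal{H})$ such that $\inf_{x\in\mathcal{H}}\big(f(x)+g(x)\big)=\sup_{\nu\in\mathcal{H}}\big(-f^*(\nu)-g^*(-\nu)\big)$. Define $F(x,\nu)=f(x)+f^*(\nu)$, $G(x,\nu)=g(x)+g^*(-\nu)$ and $$\mathcal{F}=\{(x,\nu,\tau,\kappa)\in\mathcal{H}\times\mathcal{H}\times\mathbb{R}^2\mid\widetilde{F}(x,\nu,\tau)\le-\kappa\},\qquad \mathcal{G}=\{(x,\nu,\tau,\kappa)\in\mathcal{H}\times\mathcal{H}\times\mathbb{R}^2\mid\widetilde{G}(x,\nu,\tau)\le\kappa\}.$$ Then $\mathcal{F}$ and $\mathcal{G}$ are nonempty closed convex cones, so the solution set $\mathcal{F}\cap\mathcal{G}$ of the feasibility problem ''find $(x,\nu,\tau,\kappa)$ such that $\widetilde{F}(x,\nu,\tau)\le-\kappa$ and $\widetilde{G}(x,\nu,\tau)\le\kappa$'' is a convex cone. Their polar cones are $$\mathcal{F}^{\ominus}=\{(\lambda,z,\varepsilon,\delta)\mid\widetilde{F}(z,\lambda,\delta)\le-\varepsilon\},\qquad \mathcal{G}^{\ominus}=\{(\lambda,z,\varepsilon,\delta)\mid\widetilde{G}(-z,-\lambda,-\delta)\le-\varepsilon\}.$$ Moreover the problem is self-dual: the Fenchel dual of minimizing $\iota_{\mathcal{F}}+\iota_{\mathcal{G}}$ over $\mathcal{H}\times\mathcal{H}\times\mathbb{R}^2$, namely $$\underset{(\lambda,z,\varepsilon,\delta)}{\text{maximize}}\quad-\iota_{\mathcal{F}^{\ominus}}(\lambda,z,\varepsilon,\delta)-\iota_{\mathcal{G}^{\ominus}}(-\lambda,-z,-\varepsilon,-\delta),$$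 is equivalent to the same feasibility problem, in the sense that $(\lambda,z,\varepsilon,\delta)\in\mathcal{F}^{\ominus}\cap(-\mathcal{G}^{\ominus})$ if and only if $\widetilde{F}(z,\lambda,\delta)\le-\varepsilon$ and $\widetilde{G}(z,\lambda,\delta)\le\varepsilon$, i.e. if and only if $(z,\lambda,\delta,\varepsilon)\in\mathcal{F}\cap\mathcal{G}$.
   Context: $\Gamma_0(\mathcal{H})$ is the set of proper lower semicontinuous convex functions $\mathcal{H}\to\left]-\infty,+\infty\right]$. For $h\in\Gamma_0(\mathcal{H})$: $h^*(u)=\sup_{x}(\langle x\mid u\rangle-h(x))$; $(\operatorname{rec}h)(y)=\sup_{x\in\operatorname{dom}h}(h(x+y)-h(x))$; and the perspective function is $\widetilde{h}(x,\tau)=\tau h(x/\tau)$ if $\tau>0$, $(\operatorname{rec}h)(x)$ if $\tau=0$, $+\infty$ if $\tau<0$. For $F,G\in\Gamma_0(\mathcal{H}\times\mathcal{H})$ the perspectives are functions of $((x,\nu),\tau)$, written $(x,\nu,\tau)$. Product spaces carry the sum inner product. $\iota_C$ is the indicator function of $C$ ($0$ on $C$, $+\infty$ elsewhere). The polar cone of a nonempty closed convex set $C$ is $C^{\ominus}=\{u\mid\sup_{x\in C}\langle x\mid u\rangle\le0\}$. The Fenchel dual of minimizing $\phi+\psi$ is maximizing $v\mapsto-\phi^*(v)-\psi^*(-v)$. *)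

(* Defs.v *)
From HB Require Import structures.
From mathcomp Require Import all_boot all_order all_algebra sesquilinear.
From mathcomp Require Import all_classical all_reals all_analysis.

Set Implicit Arguments.
Unset Strict Implicit.
Unset Printing Implicit Defensive.

Import Order.TTheory GRing.Theory Num.Theory.
Import numFieldNormedType.Exports.

Local Open Scope classical_set_scope.
Local Open Scope ring_scope.

(* The norm of H is the one induced by the inner product dot; with H complete,
   (H, dot) is a real Hilbert space. *)
Definition hilbert_dot (R : realType) (H : normedModType R)
    (dot : {dot H for (@idfun R)}) : Prop :=
  forall x : H, `|x| ^+ 2 = dot x x.

(* The library norm on E1 * E2 is the sup norm: it gives the product topology,
   but not the Hilbert norm, so the sum inner product is kept as a separate
   function. *)
Definition prod_dot (R : realType) (E1 E2 : Type)
    (dot1 : E1 -> E1 -> R) (dot2 : E2 -> E2 -> R) (u v : E1 * E2) : R :=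
  dot1 u.1 v.1 + dot2 u.2 v.2.

Section extended_functions.
Local Open Scope ereal_scope.

Definition domain (R : realType) (E : Type) (h : E -> \bar R) : set E :=
  [set x | h x < +oo].

Definition proper (R : realType) (E : Type) (h : E -> \bar R) : Prop :=
  domain h !=set0 /\ forall x, -oo < h x.

Definition econvex (R : realType) (E : lmodType R) (h : E -> \bar R) : Prop :=
  forall (x y : E) (t : R), (0 < t < 1)%R ->
    h (t *: x + (1 - t) *: y)%R <= t%:E * h x + (1 - t)%:E * h y.

Definition Gamma0 (R : realType) (E : normedModType R) (h : E -> \bar R)
    : Prop :=
  [/\ proper h, lower_semicontinuous h & econvex h].

Definition conjugate (R : realType) (E : Type) (dot : E -> E -> R)
    (h : E -> \bar R) (u : E) : \bar R :=
  ereal_sup [set (dot x u)%:E - h x | x in [set: E]].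

Definition recession (R : realType) (E : zmodType) (h : E -> \bar R) (y : E)
    : \bar R :=
  ereal_sup [set h (x + y)%R - h x | x in domain h].

Definition perspective (R : realType) (E : lmodType R) (h : E -> \bar R)
    (p : E * R) : \bar R :=
  let: (x, tau) := p in
  if (0 < tau)%R then tau%:E * h (tau^-1 *: x)%R
  else if tau == 0%R then recession h x
  else +oo.

Definition indicator {R : realType} {E : Type} (C : set E) (x : E) : \bar R :=
  if x \in C then 0 else +oo.

Definition polar (R : realType) (E : Type) (dot : E -> E -> R) (C : set E)
    : set E :=
  [set u | ereal_sup [set (dot x u)%:E | x in C] <= 0].

(* Objective v |-> - phi^*(v) - psi^*(-v) of the Fenchel dual of minimizing
   phi + psi. *)
Definition fenchel_dual (R : realType) (E : zmodType) (dot : E -> E -> R)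
    (phi psi : E -> \bar R) (v : E) : \bar R :=
  - conjugate dot phi v - conjugate dot psi (- v)%R.

End extended_functions.

Definition is_cone (R : realType) (E : lmodType R) (C : set E) : Prop :=
  forall (t : R) (x : E), 0 < t -> C x -> C (t *: x).

(* Main.v *)
Require Import Defs.
From HB Require Import structures.
From mathcomp Require Import all_boot all_order all_algebra sesquilinear.
From mathcomp Require Import all_classical all_reals all_analysis.
From mathcomp Require Import ring lra.

Set Implicit Arguments.
Unset Strict Implicit.
Unset Printing Implicit Defensive.

Import Order.TTheory GRing.Theory Num.Theory.
Import numFieldNormedType.Exports.

Local Open Scope classical_set_scope.
Local Open Scope ring_scope.

(** Writing [Q] for the conjugate of [P], and assuming that [P] is also the
    conjugate of [Q], the perspective of [P] is the support function of
    [{(a, s) | Q a <= - s}], for all values of the scalar variable at once: the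
    recession function of [P] is the support function of the domain of [Q], and
    letting [s] go to [-oo] gives [+oo] for a negative scalar. Hence the
    epigraph of the perspective is a polar cone, so it is a closed convex cone,
    and its own polar is read off the same description applied to [Q]. By the
    Fenchel-Moreau theorem this applies to [F] and [G], whose conjugates are [F]
    and [G] again up to the isometries [(a, b) |-> (b, a)] and
    [(a, b) |-> (- b, - a)]; this is the self-duality. *)

(** * Projection onto a closed convex set *)

(** Stated for plain functions, so that it covers [dot], the product of [R] and the sums [prod_dot]
    alike; positivity is a separate hypothesis where it is required. *)
Record symmetric_bilinear (R : realType) (E : lmodType R) (B : E -> E -> R) :=
  SymmetricBilinear {
    symbC : forall u v, B u v = B v u;
    symbDl : forall u v w, B (u + v) w = B u w + B v w;
    symbZl : forall (k : R) u v, B (k *: u) v = k * B u v }.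

Section symmetric_bilinear.
Context (R : realType) (E : lmodType R) (B : E -> E -> R).
Hypothesis Bsym : symmetric_bilinear B.

Lemma symbDr u v w : B u (v + w) = B u v + B u w.
Proof. by rewrite (symbC Bsym) (symbDl Bsym) !(symbC Bsym u). Qed.

Lemma symbZr k u v : B u (k *: v) = k * B u v.
Proof. by rewrite (symbC Bsym) (symbZl Bsym) (symbC Bsym). Qed.

Lemma symbNl u v : B (- u) v = - B u v.
Proof. by rewrite -scaleN1r (symbZl Bsym) mulN1r. Qed.

Lemma symbNr u v : B u (- v) = - B u v.
Proof. by rewrite (symbC Bsym) symbNl (symbC Bsym). Qed.

Lemma symb0l u : B 0 u = 0.
Proof. by rewrite -(scale0r 0) (symbZl Bsym) mul0r. Qed.

Lemma symb0r u : B u 0 = 0.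
Proof. by rewrite (symbC Bsym) symb0l. Qed.

End symmetric_bilinear.

Lemma symmetric_bilinear_mul (R : realType) :
  symmetric_bilinear (@GRing.mul R : R -> R -> R).
Proof.
by split=> *; [exact: mulrC | exact: mulrDl | rewrite -mulrA].
Qed.

Lemma symmetric_bilinear_prod (R : realType) (E1 E2 : lmodType R)
    (B1 : E1 -> E1 -> R) (B2 : E2 -> E2 -> R) :
  symmetric_bilinear B1 -> symmetric_bilinear B2 ->
  symmetric_bilinear (prod_dot B1 B2 : E1 * E2 -> E1 * E2 -> R).
Proof.
move=> B1sym B2sym; split=> [u v|u v w|k u v]; rewrite /prod_dot.
- by rewrite (symbC B1sym) (symbC B2sym).
- by rewrite (symbDl B1sym) (symbDl B2sym) addrACA.
- by rewrite (symbZl B1sym) (symbZl B2sym) mulrDr.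
Qed.

Lemma symmetric_bilinear_dot (R : realType) (H : lmodType R)
  (dot : {dot H for (@idfun R)}) : symmetric_bilinear (dot : H -> H -> R).
Proof.
split=> [u v|u v w|k u v]; last first.
- exact: linearZl_LR.
- exact: linearDl.
- by rewrite [LHS]hermC expr0 mul1r.
Qed.

Section nearest_point.
Context (R : realType) (E : normedModType R) (B : E -> E -> R).
Hypothesis B_symb : symmetric_bilinear B.
(** An inequality and not an equality: on [H * R] the norm is the sup norm, which the sum inner
    product only dominates. *)
Hypothesis B_ge : forall u, `|u| ^+ 2 <= B u u.
Hypothesis B_continuous : continuous (fun u => B u u).
Hypothesis E_complete : forall u : nat -> E,
  cauchy (u @ \oo) -> exists l : E, u @ \oo --> l.

Let B_ge0 u : 0 <= B u u.
Proof. by apply: le_trans (B_ge u); rewrite exprn_ge0. Qed.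

(** Parallelogram law, with the midpoint written so that [C_convex] applies to it directly. *)
Let parallelogram x y z :
  B (y - z) (y - z) = 2 * B (x - y) (x - y) + 2 * B (x - z) (x - z)
    - 4 * B (x - (2^-1 *: y + (1 - 2^-1) *: z))
            (x - (2^-1 *: y + (1 - 2^-1) *: z)).
Proof.
rewrite !(symbDl B_symb, symbDr B_symb, symbNl B_symb, symbNr B_symb).
rewrite !(symbDl B_symb, symbDr B_symb, symbZl B_symb, symbZr B_symb).
rewrite (symbC B_symb y x) (symbC B_symb z x) (symbC B_symb z y).
by field.
Qed.

Variable C : set E.
Hypothesis C_neq0 : C !=set0.
Hypothesis C_closed : closed C.
Hypothesis C_convex : forall (y z : E) (t : R),
  C y -> C z -> 0 < t < 1 -> C (t *: y + (1 - t) *: z).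

(** A minimizing sequence is Cauchy by the parallelogram law, since midpoints stay in [C]; its limit
    is in [C] and attains the infimum by continuity. *)
Lemma nearest_point x :
  exists2 p, C p & forall y, C y -> B (x - p) (x - p) <= B (x - y) (x - y).
Proof.
pose A := [set B (x - y) (x - y) | y in C]; pose d := inf A.
have A_inf : has_inf A.
  split; first by have [c Cc] := C_neq0; exists (B (x - c) (x - c)), c.
  by exists 0 => _ [y _ <-].
have dle y : C y -> d <= B (x - y) (x - y).
  by move=> Cy; apply: ge_inf; [case: A_inf | exists y].
have /choice[u Cu] n : exists y, C y /\ B (x - y) (x - y) < d + n.+1%:R^-1.
  have n0 : 0 < n.+1%:R^-1 :> R by rewrite invr_gt0.
  by have [_ [y Cy <-] ylt] := inf_adherent n0 A_inf; exists y.
(* The midpoint is at squared distance at least [d], so the two terms [2 * d] cancel and only the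
   errors remain. *)
have u_close n m : `|u n - u m| ^+ 2 <= 2 * n.+1%:R^-1 + 2 * m.+1%:R^-1.
  apply: le_trans (B_ge _) _; rewrite (parallelogram x).
  have [Cn dn] := Cu n; have [Cm dm] := Cu m.
  have := dle _ (C_convex Cn Cm (_ : 0 < 2^-1 < 1)).
  rewrite invr_gt0 ltr0n invf_lt1 ?ltr0n// ltr1n => /(_ isT).
  set w := B (x - (_ + _)) _; move: (_^-1) (_^-1) dn dm => e e' dn dm dw.
  by lra.
have /E_complete[p u_cvg] : cauchy (u @ \oo).
  apply: cauchy_exP => e e0.
  (* For indices from [N] on, each error is below [e ^+ 2 / 4], which bounds the squared distance by
     [e ^+ 2]. *)
  have e40 : 0 < e ^+ 2 / 4 by rewrite divr_gt0 ?exprn_gt0.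
  have [N _ Ne] := near_infty_natSinv_lt (PosNum e40).
  exists (u N); exists N => // n /= Nn; rewrite -ball_normE /=.
  rewrite -(ltr_pXn2r (_ : (0 < 2)%N)) ?nnegrE ?(ltW e0)//.
  apply: le_lt_trans (u_close _ _) _.
  have /= := Ne N (leqnn N); have /= := Ne n Nn.
  by move: N.+1%:R^-1 n.+1%:R^-1 => a b; lra.
have Cp : C p.
  apply: (@closed_cvg _ _ _ _ u C C_closed _ p u_cvg).
  by apply: nearW => n; case: (Cu n).
exists p => // y /dle; apply: le_trans.
have cvg_q : (fun n => B (x - u n) (x - u n)) @ \oo --> B (x - p) (x - p).
  have xu : (fun n => x - u n) @ \oo --> x - p.
    by apply: (@cvgB _ _ _ _ _ (cst x)); [exact: cvg_cst | exact: u_cvg].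
  exact: (continuous_cvg _ (B_continuous (x := x - p)) xu).
have cvg_d : (fun n => d + n.+1%:R^-1) @ \oo --> d.
  rewrite -[X in _ --> X]addr0; apply: cvgD; first exact: cvg_cst.
  exact: cvg_harmonic.
by apply: (ler_cvg_to cvg_q cvg_d); apply: nearW => n; case: (Cu n) => _ /ltW.
Qed.

(** Moving from [p] towards [y] by a fraction [t] changes the squared distance by
    [- 2 * t * s + t ^+ 2 * q], which is negative for small [t] if [s > 0]. *)
Lemma nearest_point_obtuse x p : C p ->
    (forall y, C y -> B (x - p) (x - p) <= B (x - y) (x - y)) ->
  forall y, C y -> B (x - p) (y - p) <= 0.
Proof.
move=> Cp pmin y Cy; rewrite leNgt; apply/negP => s0.
set s := B (x - p) (y - p) in s0.
pose q := B (y - p) (y - p); have q0 : 0 <= q := B_ge0 _.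
(* This value lies strictly between 0 and 1 and satisfies [t * q <= s]. *)
pose t := s / (s + q + 1).
have t01 : 0 < t < 1.
  rewrite divr_gt0 ?ltr_pdivrMr /=; lra.
have := pmin _ (C_convex Cy Cp t01).
have -> : x - (t *: y + (1 - t) *: p) = (x - p) - t *: (y - p).
  by rewrite scalerBl scale1r scalerBr addrCA opprD addrA.
have -> : B (x - p - t *: (y - p)) (x - p - t *: (y - p)) =
    B (x - p) (x - p) - 2 * t * s + t ^+ 2 * q.
  rewrite /s /q; move: (x - p) (y - p) => a b.
  rewrite !(symbDl B_symb, symbDr B_symb, symbNl B_symb, symbNr B_symb).
  by rewrite !(symbZl B_symb, symbZr B_symb) (symbC B_symb b a); ring.
have tq : t * q <= s.
  rewrite /t mulrAC ler_pdivrMr; nra.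
case/andP: t01 => t0 _; nra.
Qed.

(** The normal is [x - p] with [p] the nearest point; the separation is strict because [B v v] is
    positive for [v = x - p]. *)
Lemma closed_convex_separation x : ~ C x ->
  exists v, exists2 c, (forall y, C y -> B v y <= c) & c < B v x.
Proof.
move=> Cx; have [p Cp pmin] := nearest_point x.
exists (x - p), (B (x - p) p).
  move=> y /(nearest_point_obtuse Cp pmin).
  by rewrite (symbDr B_symb) (symbNr B_symb) subr_le0.
rewrite -subr_gt0 -(symbNr B_symb) -(symbDr B_symb).
apply: lt_le_trans (B_ge _).
rewrite exprn_gt0// normr_gt0 subr_eq0; apply/eqP => xp.
by apply: Cx; rewrite xp.
Qed.
End nearest_point.

(** * The Fenchel-Moreau theorem *)

Lemma prod_cauchy_cvg (R : realType) (U V : completeNormedModType R)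
    (u : nat -> U * V) : cauchy (u @ \oo) -> exists l : U * V, u @ \oo --> l.
Proof.
move=> /cauchy_ballP u_cauchy.
have cvg1 : cvgn (fst \o u).
  apply/cauchy_cvgP/cauchy_ballP => e e0; have := u_cauchy e e0.
  by rewrite !near_map2; apply: filterS => -[i j] /= [].
have cvg2 : cvgn (snd \o u).
  apply/cauchy_cvgP/cauchy_ballP => e e0; have := u_cauchy e e0.
  by rewrite !near_map2; apply: filterS => -[i j] /= [].
exists (lim (fst \o u @ \oo), lim (snd \o u @ \oo)).
have -> : u = (fun n => ((fst \o u) n, (snd \o u) n)).
  by apply/funext => n /=; case: (u n).
exact: cvg_pair.
Qed.

(** * Extended real inequalities tested on real upper bounds *)

Section real_upper_bounds.
Local Open Scope ereal_scope.

Lemma lee_real_ub (R : realType) (a b : \bar R) :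
  (forall r, b <= r%:E -> a <= r%:E) -> a <= b.
Proof.
case: b => [b||] ab; [exact: ab | exact: leey |].
case: a ab => [a||] ab; last by [].
- by have := ab (a - 1)%R (leNye _); rewrite lee_fin => ?; exfalso; lra.
- by have := ab 0%R (leNye _); rewrite leye_eq.
Qed.

Lemma eq_real_ub (R : realType) (a b : \bar R) :
  (forall r, a <= r%:E <-> b <= r%:E) -> a = b.
Proof.
move=> ab; apply/eqP; rewrite eq_le.
by apply/andP; split; apply: lee_real_ub => r; rewrite ab.
Qed.

(** Quantifying over points [(x, r)] of the epigraph replaces extended real subtraction by real
    inequalities. *)
Lemma conjugate_leP (R : realType) (E : Type) (dot : E -> E -> R)
    (h : E -> \bar R) (u : E) (c : R) : (forall x, -oo < h x) ->
  conjugate dot h u <= c%:E <->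
  forall x r, h x <= r%:E -> (dot x u <= c + r)%R.
Proof.
move=> hNy; split=> [hu x r hxr | hu].
  have : (dot x u)%:E - h x <= c%:E.
    by apply: le_trans hu; apply: ereal_sup_ubound; exists x.
  case: (h x) (hNy x) hxr => [a||] //= _.
  rewrite -EFinB !lee_fin; lra.
apply: ge_ereal_sup => _ [x _ <-].
case: (h x) (hNy x) (hu x) => [a||] //= _ hx.
  by rewrite -EFinB lee_fin lerBlDr; exact: hx.
by rewrite addeNy leNye.
Qed.

End real_upper_bounds.

Lemma proper_fin (R : realType) (E : Type) (h : E -> \bar R) :
  Defs.proper h -> exists x r, h x = r%:E.
Proof.
move=> [[x hx] hNy]; exists x, (fine (h x)).
by rewrite fineK// fin_numElt hNy.
Qed.

Lemma conjugate_gtNy (R : realType) (E : Type) (dot : E -> E -> R)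
    (h : E -> \bar R) u : Defs.proper h -> (-oo < conjugate dot h u)%E.
Proof.
move=> /proper_fin[x [r xr]].
apply: (@lt_le_trans _ _ ((dot x u)%:E - h x)%E).
  by rewrite xr -EFinB ltNyr.
by apply: ereal_sup_ubound; exists x.
Qed.

Section fenchel_moreau.
Context (R : realType) (H : completeNormedModType R) (dot : H -> H -> R).
Hypothesis dot_symb : symmetric_bilinear dot.
Hypothesis dot_norm : forall x, `|x| ^+ 2 = dot x x.

(** Polarization expresses the inner product by norms, which are continuous. *)
Lemma dot_continuous (a : H) : continuous (fun x => dot x a).
Proof.
have dotE x : dot x a = (`|x + a| ^+ 2 - `|x| ^+ 2 - `|a| ^+ 2) / 2.
  rewrite !dot_norm !(symbDl dot_symb) !(symbDr dot_symb) (symbC dot_symb a x).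
  by field.
under eq_fun do rewrite dotE.
have norm2_continuous : continuous (fun x : H => `|x| ^+ 2).
  move=> x; apply: (@continuous_comp _ _ _ (fun y : H => `|y|)
    (fun r : R => r ^+ 2)).
    exact: norm_continuous.
  exact: exprn_continuous.
move=> x; apply: cvgMl; apply: cvgB; last exact: cvg_cst.
apply: cvgB; last exact: norm2_continuous.
apply: (@continuous_comp _ _ _ (fun x : H => x + a) (fun y : H => `|y| ^+ 2)).
  by apply: cvgD; [exact: cvg_id | exact: cvg_cst].
exact: norm2_continuous.
Qed.

Variable f : H -> \bar R.
Hypothesis f_Gamma0 : Gamma0 f.

Let epi := [set p : H * R | (f p.1 <= p.2%:E)%E].

(** If [r < a < f y], lower semicontinuity keeps [f] above [a] near [y], and scalars near [r] stay
    below [a]; hence the complement is open. *)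
Lemma epi_closed : closed epi.
Proof.
have [_ f_lsc _] := f_Gamma0.
rewrite -openC openE => -[y r] /= /negP; rewrite -ltNge => rfy.
have [a ra /f_lsc[V yV Va]] : exists2 a : R, r < a & (a%:E < f y)%E.
  case: (f y) rfy => [b||//] rfy; last by exists (r + 1); rewrite ?ltry ?ltrDl.
  by rewrite lte_fin in rfy; exists ((r + b) / 2); rewrite ?lte_fin !midf_lt.
exists (V, [set s | s < a]) => /=; first by split => //; exact: lt_nbhsl.
move=> [z s] /= [/Va az sa]; apply/negP; rewrite -ltNge.
by apply: lt_trans az; rewrite lte_fin.
Qed.

Lemma epi_convex (p q : H * R) (t : R) :
  epi p -> epi q -> 0 < t < 1 -> epi (t *: p + (1 - t) *: q).
Proof.
have [_ _ f_convex] := f_Gamma0.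
case: p q => [x r] [y s] /= xr ys t01; rewrite /epi /=.
apply: le_trans (f_convex _ _ _ t01) _; case/andP: t01 => t0 t1.
have -> : (t *: r + (1 - t) *: s)%:E =
  (t%:E * r%:E + (1 - t)%:E * s%:E)%E by [].
by apply: leeD; apply: lee_wpmul2l => //; rewrite lee_fin ?subr_ge0 ltW.
Qed.

Lemma epi_separation x c : (c%:E < f x)%E ->
  exists v w k, (forall y r, (f y <= r%:E)%E -> dot v y + w * r <= k)
    /\ k < dot v x + w * c.
Proof.
move=> cfx; pose B := prod_dot dot (@GRing.mul R).
have Bsymb : symmetric_bilinear B.
  exact: symmetric_bilinear_prod (symmetric_bilinear_mul R).
have BE (p : H * R) : B p p = `|p.1| ^+ 2 + p.2 ^+ 2.
  by rewrite /B /prod_dot -dot_norm.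
have [|||||||[v w] [k Ck kx]] :=
  @closed_convex_separation R (H * R)%type B Bsymb _ _ _ epi _ _ _ (x, c).
- move=> [a s]; rewrite BE /=.
  have max_sqr (r t : R) : (Num.max r `|t|) ^+ 2 <= r ^+ 2 + t ^+ 2.
    have t2 : `|t| ^+ 2 = t ^+ 2 by exact: real_normK (num_real t).
    by case: (leP r `|t|) => _; rewrite ?t2 ?lerDl ?lerDr sqr_ge0.
  exact: max_sqr.
- under eq_fun do rewrite BE.
  move=> p; apply: cvgD.
    apply: (@continuous_comp _ _ _ (fun p : H * R => `|p.1|)
      (fun r : R => r ^+ 2)); last exact: exprn_continuous.
    apply: (@continuous_comp _ _ _ fst (fun y : H => `|y|)).
      exact: cvg_fst.
    exact: norm_continuous.
  apply: (@continuous_comp _ _ _ snd (fun r : R => r ^+ 2)).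
    exact: cvg_snd.
  exact: exprn_continuous.
- exact: prod_cauchy_cvg.
- have [/proper_fin[y [r fyr]] _ _] := f_Gamma0.
  by exists (y, r); rewrite /epi /= fyr.
- exact: epi_closed.
- exact: epi_convex.
- by rewrite /epi /= leNgt cfx.
exists v, w, k; split=> // y r yr.
exact: (Ck (y, r)).
Qed.

(** Dividing by [- w > 0] turns the hyperplane into the graph of an affine function below [f] whose
    value at [x] exceeds [c]. *)
Lemma nonvertical_separation x c v w k : w < 0 ->
    (forall y r, (f y <= r%:E)%E -> dot v y + w * r <= k) ->
    k < dot v x + w * c ->
  exists u s, (forall y r, (f y <= r%:E)%E -> dot y u <= s + r)
    /\ c < dot x u - s.
Proof.
move=> w0 vk kx; exists ((- w)^-1 *: v), (k / - w).
have wN0 : 0 < - w by rewrite oppr_gt0.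
split=> [y r /vk|]; rewrite (symbZr dot_symb) (symbC dot_symb _ v).
  move=> yk; rewrite mulrC ler_pdivrMr// mulrDl divfK ?gt_eqF//; lra.
rewrite mulrC -mulrBl ltr_pdivlMr//; lra.
Qed.

Lemma affine_minorant x c : (c%:E < f x)%E ->
  exists u s, (forall y r, (f y <= r%:E)%E -> dot y u <= s + r)
    /\ c < dot x u - s.
Proof.
have [/proper_fin[z [r fz]] _ _] := f_Gamma0.
(* At a point where [f] is finite, comparing the heights [r] and [r - 1] forces [w < 0], so one
   affine minorant exists. *)
have [u0 [s0 [us0 _]]] : exists u s,
    (forall y t, (f y <= t%:E)%E -> dot y u <= s + t) /\ r - 1 < dot z u - s.
  have /epi_separation[v [w [k [vk kz]]]] : ((r - 1)%:E < f z)%E.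
    by rewrite fz lte_fin ltrBlDr ltrDl.
  apply: (nonvertical_separation _ vk kz).
  have := vk z r; rewrite fz lexx => /(_ isT); lra.
move=> /epi_separation[v [w [k [vk kx]]]].
have [w0|w0|w0] := ltgtP w 0; first exact: (nonvertical_separation _ vk kx).
  (* For [w > 0] the bound fails high up in the epigraph: [t] is large enough that
     [dot v z + w * t > k]. *)
  exfalso; pose t := r + `|k - dot v z - w * r| / w + 1.
  have /vk : (f z <= t%:E)%E.
    by rewrite fz lee_fin /t -addrA lerDl addr_ge0 ?divr_ge0// ltW.
  rewrite /t !mulrDr mulrCA divff ?gt_eqF// !mulr1.
  have := ler_norm (k - dot v z - w * r); lra.
(* A vertical hyperplane: adding a large multiple of it to the affine minorant
   [u0, s0] lifts the value at [x] above [c]. *)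
rewrite w0 mul0r addr0 in kx.
have vd y t : (f y <= t%:E)%E -> dot v y <= k.
  by move=> /vk; rewrite w0 mul0r addr0.
pose n := (`|c - dot x u0 + s0| + 1) / (dot v x - k).
have n0 : 0 <= n by rewrite divr_ge0 ?subr_ge0 ?(ltW kx) ?addr_ge0.
exists (u0 + n *: v), (s0 + n * k).
split=> [y t yt|]; rewrite (symbDr dot_symb) (symbZr dot_symb).
  have := us0 _ _ yt; have := ler_wpM2l n0 (vd _ _ yt).
  rewrite (symbC dot_symb v); lra.
rewrite (symbC dot_symb _ v).
have -> : dot x u0 + n * dot v x - (s0 + n * k) =
    dot x u0 - s0 + n * (dot v x - k) by ring.
rewrite /n divfK ?gt_eqF ?subr_gt0//.
have := ler_norm (c - dot x u0 + s0); lra.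
Qed.

Local Open Scope ereal_scope.

(** An affine minorant of slope [u] and offset [s] says exactly that the conjugate is at most [s] at
    [u]. *)
Lemma conjugate_proper : Defs.proper (conjugate dot f).
Proof.
have [f_proper _ _] := f_Gamma0; have [_ fNy] := f_proper.
have [z [r fz]] := proper_fin f_proper; split.
  have /affine_minorant[u [s [us _]]] : (r - 1)%:E < f z.
    by rewrite fz lte_fin ltrBlDr ltrDl.
  exists u; rewrite /domain /=; apply: le_lt_trans (ltry s).
  exact/(conjugate_leP _ _ _ fNy).
by move=> u; exact: conjugate_gtNy.
Qed.

(** If the biconjugate were at most [r < f x], an affine minorant exceeding [r] at [x] would
    contradict it; the other direction is the Fenchel-Young inequality. *)
Lemma fenchel_moreau : conjugate dot (conjugate dot f) = f.
Proof.
have [[_ fNy] _ _] := f_Gamma0; have [_ fsNy] := conjugate_proper.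
apply/funext => x; apply: eq_real_ub => r; split.
  move=> /(conjugate_leP _ _ _ fsNy) xr; rewrite leNgt; apply/negP.
  move=> /affine_minorant[u [s [us ltr]]].
  have : (dot u x <= r + s)%R by apply/xr/(conjugate_leP _ _ _ fNy).
  rewrite (symbC dot_symb); lra.
move=> xr; apply/(conjugate_leP _ _ _ fsNy) => u s /(conjugate_leP _ _ _ fNy).
by move=> /(_ _ _ xr); rewrite (symbC dot_symb) addrC.
Qed.

End fenchel_moreau.

(** * Polar cones and perspective functions *)

Lemma ereal_sup_imageP (R : realType) (I : Type) (D : set I)
    (h : I -> \bar R) c :
  (ereal_sup [set h i | i in D] <= c)%E <-> forall i, D i -> (h i <= c)%E.
Proof.
split=> [hc i Di | hc]; last by apply: ge_ereal_sup => _ [i Di <-]; exact: hc.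
by apply: le_trans hc; apply: ereal_sup_ubound; exists i.
Qed.

Section polar.
Context (R : realType) (E : normedModType R) (B : E -> E -> R).
Hypothesis B_symb : symmetric_bilinear B.
Hypothesis B_continuous : forall a, continuous (fun u => B u a).

Lemma polarP (C : set E) u : polar B C u <-> forall x, C x -> B x u <= 0.
Proof.
rewrite /polar /= ereal_sup_imageP.
by split=> Cu x /Cu; rewrite lee_fin.
Qed.

Lemma polar0 (C : set E) : polar B C 0.
Proof. by apply/polarP => x _; rewrite (symb0r B_symb). Qed.

Lemma polar_closed (C : set E) : closed (polar B C).
Proof.
have -> : polar B C = \bigcap_(x in C) [set u | B u x <= 0].
  apply/seteqP; split=> u /=.
    by move=> /polarP Cu x /Cu; rewrite (symbC B_symb).
  by move=> Cu; apply/polarP => x /Cu; rewrite /= (symbC B_symb).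
apply: closed_bigI => x _.
apply: (@preimage_closed _ _ (fun u => B u x) [set r | r <= 0]).
  by move=> u _; exact: B_continuous.
exact: closed_le.
Qed.

Lemma polar_convex (C : set E) : convex_set (polar B C).
Proof.
move=> u v l; rewrite !inE => /polarP Cu /polarP Cv; apply/polarP => x Cx.
rewrite /conv /= (symbDr B_symb) !(symbZr B_symb).
have [Bu Bv] := (Cu _ Cx, Cv _ Cx).
have [l0 l1] : 0 <= l%:num /\ l%:num <= 1 by [].
by rewrite -(addr0 0) lerD// mulr_ge0_le0 ?subr_ge0.
Qed.

Lemma polar_cone (C : set E) : is_cone (polar B C).
Proof.
move=> t u t0 /polarP Cu; apply/polarP => x /Cu Bu.
by rewrite (symbZr B_symb) pmulr_rle0.
Qed.

(** On a cone a positive value of [B x v] scales past every bound, so the supremum is either 0,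
    attained at the origin, or [+oo]. *)
Lemma conjugate_indicator (C : set E) : C 0 -> is_cone C ->
  conjugate B (indicator C) = indicator (polar B C).
Proof.
move=> C0 C_cone; apply/funext => v; apply: eq_real_ub => r.
rewrite conjugate_leP; last by move=> x; rewrite /indicator; case: ifP.
rewrite [X in _ <-> (X <= _)%E]/indicator; split=> [Cr | vr x s].
  have Cr' x : C x -> B x v <= r.
    by move=> Cx; rewrite -[r]addr0; apply: Cr; rewrite /indicator mem_set.
  have r0 : 0 <= r by rewrite -(symb0l B_symb v) Cr'.
  suff /mem_set-> : polar B C v by rewrite lee_fin.
  apply/polarP => x Cx; rewrite leNgt; apply/negP => xv0.
  (* The factor is chosen so that the scaled point has value [r + 1]. *)
  have /Cr' : C (((r + 1) / B x v) *: x).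
    by apply: C_cone => //; rewrite divr_gt0// ltr_wpDl.
  rewrite (symbZl B_symb) divfK ?gt_eqF//; lra.
case: ifP vr => [/set_mem/polarP Cv|//]; rewrite lee_fin => r0.
rewrite /indicator; case: ifP => [/set_mem/Cv|//]; rewrite lee_fin; lra.
Qed.

End polar.

(** * Perspectives of two mutually conjugate functions *)

Section conjugate_pair.
Context (R : realType) (E : lmodType R) (B : E -> E -> R) (P Q : E -> \bar R).
Hypothesis B_symb : symmetric_bilinear B.
Hypothesis P_proper : Defs.proper P.
Hypothesis Q_proper : Defs.proper Q.
Hypothesis PQ : conjugate B P = Q.
Hypothesis QP : conjugate B Q = P.

Let P_leP w c :
  (P w <= c%:E)%E <-> forall a s, (Q a <= s%:E)%E -> B a w <= c + s.
Proof. by rewrite -QP conjugate_leP//; case: Q_proper. Qed.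

Let Q_leP a c :
  (Q a <= c%:E)%E <-> forall w r, (P w <= r%:E)%E -> B w a <= c + r.
Proof. by rewrite -PQ conjugate_leP//; case: P_proper. Qed.

(** Clearing the difference says that translation by [(w, k)] maps the epigraph of [P] into
    itself. *)
Let recession_leP w k :
  (recession P w <= k%:E)%E <->
  forall x r, (P x <= r%:E)%E -> (P (x + w) <= (k + r)%:E)%E.
Proof.
have [_ PNy] := P_proper; rewrite /recession ereal_sup_imageP /domain /=.
split=> [Pw x r xr | Pw x].
  have /Pw : (P x < +oo)%E by apply: le_lt_trans (ltry r).
  case: (P x) xr (PNy x) => [q||] //; rewrite lee_fin => qr _.
  by rewrite leeBlDr// -EFinD => /le_trans; apply; rewrite lee_fin lerD2l.
case Px : (P x) (PNy x) => [r||] // _ _.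
by rewrite leeBlDr// -EFinD; apply: Pw; rewrite Px.
Qed.

Lemma perspective_leP w t k :
  (perspective P (w, t) <= k%:E)%E <->
  forall a s, (Q a <= s%:E)%E -> B w a <= k + t * s.
Proof.
rewrite /perspective; case: (ltgtP 0 t) => [t0|t0|<-].
- rewrite -lee_pdivlMl// -EFinM P_leP.
  split=> Pw a s /Pw; rewrite (symbZr B_symb) (symbC B_symb a) => aw.
    have := ler_wpM2l (ltW t0) aw.
    by rewrite mulrA mulrDr mulrA divff ?gt_eqF// !mul1r.
  by rewrite -(ler_pM2l t0) mulrA mulrDr mulrA divff ?gt_eqF// !mul1r.
(* For [t < 0], raising [s] above a finite value of [Q] drives [k + t * s] below any bound; [d] is
   one more than the gap to be closed. *)
- rewrite leye_eq; split=> // Pw; exfalso.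
  have [a [q aq]] := proper_fin Q_proper.
  pose d := `|k + t * q - B w a| + 1.
  have : B w a <= k + t * (q + d / - t).
    apply: Pw; rewrite aq lee_fin lerDl divr_ge0 ?addr_ge0//; lra.
  have -> : k + t * (q + d / - t) = k + t * q - d by field; rewrite lt_eqF.
  have := ler_norm (k + t * q - B w a); rewrite /d; lra.
- rewrite recession_leP; split=> [Pw a s as_ | Pw x r xr].
    rewrite mul0r addr0 leNgt; apply/negP => kwa.
    have [_ QNy] := Q_proper.
    case aq : (Q a) as_ (QNy a) => [q||] // _ _.
    (* Translating the epigraph of [P] by [(w, k)] would improve the value [q] of the conjugate at
       [a] by [B w a - k > 0]. *)
    have : (Q a <= (q - (B w a - k))%:E)%E.
      apply/Q_leP => x r /Pw/P_leP/(_ a q); rewrite aq lexx => /(_ isT).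
      rewrite (symbDr B_symb) !(symbC B_symb a); lra.
    rewrite aq lee_fin; lra.
  apply/P_leP => a s as_; rewrite (symbDr B_symb) !(symbC B_symb a).
  have := Pw _ _ as_; have := (Q_leP _ _).1 as_ _ _ xr; lra.
Qed.

End conjugate_pair.

Lemma perspective_polar (R : realType) (E : lmodType R) (B : E -> E -> R)
    (P Q : E -> \bar R) : symmetric_bilinear B ->
    Defs.proper P -> Defs.proper Q ->
    conjugate B P = Q -> conjugate B Q = P ->
  forall u e d,
  (forall w t k, (perspective P (w, t) <= k%:E)%E ->
    B w u + t * e + k * d <= 0) <->
  (perspective Q (u, (- d)%R) <= (- e)%:E)%E.
Proof.
move=> B_symb P_proper Q_proper PQ QP u e d.
have P_leP := perspective_leP B_symb P_proper Q_proper PQ QP.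
rewrite (perspective_leP B_symb Q_proper P_proper QP PQ).
have [_ PNy] := P_proper; have [_ QNy] := Q_proper.
split=> [Pu w s ws | Qu w t k].
  have : B w u + 1 * e + s * d <= 0.
    (* The slice [t = 1], where the perspective is [P] itself, gives all the required
       inequalities. *)
    apply: Pu; apply/P_leP => a r; rewrite -PQ => /(conjugate_leP _ _ _ PNy).
    by move=> /(_ _ _ ws); rewrite mul1r addrC.
  rewrite (symbC B_symb u); lra.
move=> /P_leP Pw.
have [x [p xp]] := proper_fin P_proper.
(* If [d > 0], going up in the epigraph of [P] over [x] violates the bound [Qu]. *)
have d0 : d <= 0.
  rewrite leNgt; apply/negP => d0.
  pose c := `|- e - d * p - B u x| + 1.
  have : B u x <= - e + (- d) * (p + c / d).
    by apply: Qu; rewrite xp lee_fin lerDl divr_ge0 ?addr_ge0// ltW.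
  have -> : - e + (- d) * (p + c / d) = - e - d * p - c.
    by field; rewrite gt_eqF.
  have := ler_norm (- e - d * p - B u x); rewrite /c; lra.
move: d0; rewrite le_eqVlt => /predU1P[d0|d0].
  (* [(u, - e)] is a direction of recession of the epigraph of [Q]. *)
  have [a [r ar]] := proper_fin Q_proper.
  have Pn n : 0 <= n -> B w a + n * B w u <= k + t * (r - n * e).
    move=> n0; rewrite -(symbZr B_symb) -(symbDr B_symb); apply: Pw.
    rewrite -PQ; apply/(conjugate_leP _ _ _ PNy) => y s ys.
    have : B y a <= r + s.
      by apply: (conjugate_leP B a r PNy).1 ys; rewrite PQ ar.
    have := ler_wpM2l n0 (Qu _ _ ys); rewrite d0 oppr0 mul0r addr0.
    rewrite (symbDr B_symb) (symbZr B_symb) (symbC B_symb y u); lra.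
  rewrite d0 mulr0 addr0 leNgt; apply/negP => wu0.
  (* Taking [n = c / (B w u + t * e)] in [Pn] makes the left side exceed the right side. *)
  pose c := `|k + t * r - B w a| + 1.
  have : B w a + c / (B w u + t * e) * (B w u + t * e) <= k + t * r.
    have /Pn : 0 <= c / (B w u + t * e).
      by rewrite divr_ge0 ?(ltW wu0) ?addr_ge0.
    lra.
  rewrite divfK ?gt_eqF//.
  have := ler_norm (k + t * r - B w a); rewrite /c; lra.
have dN0 : 0 < - d by rewrite oppr_gt0.
(* For [d < 0] a single point of the epigraph of [Q] suffices: [(u, - e)] rescaled by [(- d)^-1]. *)
have : (Q ((- d)^-1 *: u) <= (- e / - d)%:E)%E.
  rewrite -PQ; apply/(conjugate_leP _ _ _ PNy) => y s /Qu.
  rewrite (symbZr B_symb) (symbC B_symb y) [_^-1 * _]mulrC.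
  rewrite ler_pdivrMr// mulrDl divfK ?gt_eqF//; lra.
move=> /Pw; rewrite (symbZr B_symb) [_^-1 * _]mulrC ler_pdivrMr// mulrDl -mulrA.
rewrite divfK ?gt_eqF//; lra.
Qed.

(** * Sums, sign changes and linear substitutions *)

(** The supremum is taken over [x] for fixed [y] first; this makes the conjugate of [p] finite, so
    it can be subtracted before [y] varies. *)
Lemma conjugate_sum (R : realType) (E1 E2 : Type) (d1 : E1 -> E1 -> R)
    (d2 : E2 -> E2 -> R) (p : E1 -> \bar R) (q : E2 -> \bar R) :
    Defs.proper p -> Defs.proper q ->
  conjugate (prod_dot d1 d2) (fun z => p z.1 + q z.2)%E =
  (fun z => conjugate d1 p z.1 + conjugate d2 q z.2)%E.
Proof.
move=> p_proper q_proper; have [[_ pNy] [_ qNy]] := (p_proper, q_proper).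
have [y0 [s0 ys0]] := proper_fin q_proper.
apply/funext => -[a b] /=; apply: eq_real_ub => c.
have p'Ny := conjugate_gtNy d1 a p_proper.
have q'Ny := conjugate_gtNy d2 b q_proper.
rewrite conjugate_leP; last first.
  move=> [x y] /=; move: (pNy x) (qNy y).
  by case: (p x) => [?||] //; case: (q y) => [?||] // _ _; rewrite -EFinD ltNyr.
split=> [h|].
  have p_le y s : (q y <= s%:E)%E ->
      (conjugate d1 p a <= (c + s - d2 y b)%:E)%E.
    move=> ys; apply/(conjugate_leP _ _ _ pNy) => x r xr.
    have := h (x, y) (r + s); rewrite /prod_dot /= EFinD.
    move=> /(_ (leeD xr ys)); lra.
  case p'a : (conjugate d1 p a) p'Ny (p_le y0 s0) => [r'||] // _; last first.
    by rewrite ys0 lexx => /(_ isT).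
  move=> _; rewrite -leeBrDl//; apply/(conjugate_leP _ _ _ qNy) => y s /p_le.
  rewrite p'a lee_fin; lra.
case p'a : (conjugate d1 p a) p'Ny => [p'||] // _;
  case q'b : (conjugate d2 q b) q'Ny => [q'||] // _.
rewrite -EFinD lee_fin => p'q'c [x y] r /=.
have := (conjugate_leP d1 a p' pNy).1; rewrite p'a lexx => /(_ isT x).
have := (conjugate_leP d2 b q' qNy).1; rewrite q'b lexx => /(_ isT y).
case: (p x) (pNy x) => [px||] // _; case: (q y) (qNy y) => [qy||] // _.
move=> /(_ _ (lexx _)) yb /(_ _ (lexx _)) xa.
rewrite -EFinD lee_fin /prod_dot /=; lra.
Qed.

Lemma conjugate_opp (R : realType) (E : lmodType R) (B : E -> E -> R)
    (h : E -> \bar R) : symmetric_bilinear B ->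
  conjugate B (fun x => h (- x)) = (fun u => conjugate B h (- u)).
Proof.
move=> B_symb; apply/funext => u; congr ereal_sup; apply/seteqP.
split=> _ [x _ <-]; exists (- x) => //.
  by rewrite (symbNl B_symb) (symbNr B_symb) opprK.
by rewrite (symbNl B_symb) (symbNr B_symb) !opprK.
Qed.

(** The right inverse [T'] makes [T] map the domain of the composite onto that of [h], so the
    recession functions agree too. *)
Lemma perspective_comp (R : realType) (E1 E2 : lmodType R) (h : E2 -> \bar R)
    (T : E1 -> E2) (T' : E2 -> E1) : cancel T' T ->
    {morph T : x y / x + y} -> (forall k : R, {morph T : x / k *: x}) ->
  forall w t, perspective (fun x => h (T x)) (w, t) = perspective h (T w, t).
Proof.
move=> T'K TD TZ w t; rewrite /perspective TZ.
case: ifP => // _; case: ifP => // _; congr ereal_sup.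
apply/seteqP; split=> _ [x xh <-].
  by exists (T x); rewrite -?TD.
by exists (T' x); rewrite /domain /= ?TD T'K.
Qed.

Lemma prod_dot_continuous (R : realType) (E1 E2 : normedModType R)
    (d1 : E1 -> E1 -> R) (d2 : E2 -> E2 -> R) :
    (forall a, continuous (fun u => d1 u a)) ->
    (forall a, continuous (fun u => d2 u a)) ->
  forall a, continuous (fun u : E1 * E2 => prod_dot d1 d2 u a).
Proof.
move=> d1_continuous d2_continuous a u; apply: cvgD.
  apply: (@continuous_comp _ _ _ fst (fun v => d1 v a.1)); first exact: cvg_fst.
  exact: d1_continuous.
apply: (@continuous_comp _ _ _ snd (fun v => d2 v a.2)); first exact: cvg_snd.
exact: d2_continuous.
Qed.

Lemma mul_continuous (R : realType) (a : R) : continuous (fun u : R => u * a).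
Proof. by move=> u; apply: cvgMl; exact: cvg_id. Qed.

(** * Epigraphs of perspectives as polar cones *)

Section perspective_cone.
Context (R : realType) (E : normedModType R) (B : E -> E -> R).
Variables P Q : E -> \bar R.
Hypothesis B_symb : symmetric_bilinear B.
Hypothesis B_continuous : forall a, continuous (fun u => B u a).
Hypothesis P_proper : Defs.proper P.
Hypothesis Q_proper : Defs.proper Q.
Hypothesis PQ : conjugate B P = Q.
Hypothesis QP : conjugate B Q = P.

Let B3 : E * R * R -> E * R * R -> R := prod_dot (prod_dot B *%R) *%R.

Lemma perspective_cone_symb : symmetric_bilinear B3.
Proof.
apply: symmetric_bilinear_prod; last exact: symmetric_bilinear_mul.
exact: symmetric_bilinear_prod (symmetric_bilinear_mul R).
Qed.

Lemma perspective_cone_continuous a : continuous (fun u => B3 u a).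
Proof.
apply: prod_dot_continuous; last exact: mul_continuous.
by apply: prod_dot_continuous => //; exact: mul_continuous.
Qed.

(* With sigma = 1 this is the epigraph of the perspective of P, with
   sigma = -1 the reflected epigraph. *)
Variable sigma : R.
Hypothesis sigmaK : sigma * sigma = 1.

Definition perspective_cone : set (E * R * R) :=
  [set u | (perspective P u.1 <= (sigma * u.2)%:E)%E].

(** [perspective_leP] read as polarity to the vectors [(a, - s, - sigma)] with [Q a <= s];
    closedness, convexity and the cone property are then those of any polar. *)
Lemma perspective_cone_bipolar :
  perspective_cone =
  polar B3 [set v | (Q v.1.1 <= (- v.1.2)%:E)%E /\ v.2 = - sigma].
Proof.
apply/seteqP; split=> -[[w t] k]; rewrite /perspective_cone /=.
  move=> /(perspective_leP B_symb P_proper Q_proper PQ QP) Pw.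
  apply/polarP => -[[a s] l] /= [as_ ->]; have := Pw _ _ as_.
  rewrite /B3 /prod_dot /= (symbC B_symb a); lra.
move=> /polarP Pw; apply/(perspective_leP B_symb P_proper Q_proper PQ QP).
move=> a s as_; have := Pw (a, - s, - sigma); rewrite /= opprK.
move=> /(_ (conj as_ erefl)).
rewrite /B3 /prod_dot /= (symbC B_symb a); lra.
Qed.

(** The involution [k |-> sigma * k] carries the cone to the epigraph, so [perspective_polar]
    applies with [sigma * d] for [d]. *)
Lemma polar_perspective_cone : polar B3 perspective_cone =
  [set u | (perspective Q (u.1.1, (- (sigma * u.2))%R) <= (- u.1.2)%:E)%E].
Proof.
have Q_leP := perspective_polar B_symb P_proper Q_proper PQ QP.
apply/seteqP; split=> -[[u e] d] /=.
  move=> /polarP Pu; apply/Q_leP => w t k Pw.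
  have := Pu (w, t, sigma * k); rewrite /perspective_cone /= mulrA sigmaK mul1r.
  by move=> /(_ Pw); rewrite /B3 /prod_dot /= mulrCA mulrA.
move=> /Q_leP Pu; apply/polarP => -[[w t] k] /Pu.
by rewrite /B3 /prod_dot /= mulrACA sigmaK mul1r.
Qed.

End perspective_cone.

Lemma proper_separable_sum (R : realType) (E1 E2 : Type) (p : E1 -> \bar R)
    (q : E2 -> \bar R) :
  Defs.proper p -> Defs.proper q -> Defs.proper (fun z => p z.1 + q z.2)%E.
Proof.
move=> p_proper q_proper; have [[_ pNy] [_ qNy]] := (p_proper, q_proper).
have [x0 [r0 xr0]] := proper_fin p_proper.
have [y0 [s0 ys0]] := proper_fin q_proper.
split; first by exists (x0, y0); rewrite /domain /= xr0 ys0 -EFinD ltry.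
by move=> [x y] /=; rewrite ltNye adde_eq_ninfty negb_or -!ltNye pNy qNy.
Qed.

Lemma proper_opp (R : realType) (E : zmodType) (h : E -> \bar R) :
  Defs.proper h -> Defs.proper (fun x => h (- x)).
Proof.
by move=> [[x hx] hNy]; split=> //; exists (- x); rewrite /domain /= opprK.
Qed.

(** * The feasibility problem and its self-duality *)

Theorem mainTheorem2 (R : realType) (H : completeNormedModType R)
    (dot : {dot H for (@idfun R)}) (dot_hilbert : hilbert_dot dot)
    (f g : H -> \bar R) (f_Gamma0 : Gamma0 f) (g_Gamma0 : Gamma0 g)
    (duality :
      ereal_inf [set (f x + g x)%E | x in [set: H]] =
      ereal_sup [set (- conjugate dot f nu - conjugate dot g (- nu)%R)%E
                | nu in [set: H]]) :
  let F (p : H * H) : \bar R := (f p.1 + conjugate dot f p.2)%E in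
  let G (p : H * H) : \bar R := (g p.1 + conjugate dot g (- p.2)%R)%E in
  let space := (H * H * R * R)%type in
  let dot4 : space -> space -> R :=
    prod_dot (prod_dot (prod_dot dot dot) *%R) *%R in
  let calF : set space := [set u | let: (x, nu, tau, kappa) := u in
    (perspective F (x, nu, tau) <= (- kappa)%:E)%E] in
  let calG : set space := [set u | let: (x, nu, tau, kappa) := u in
    (perspective G (x, nu, tau) <= kappa%:E)%E] in
  [/\
   [/\ calF !=set0, closed calF, convex_set calF & is_cone calF]
     /\ [/\ calG !=set0, closed calG, convex_set calG & is_cone calG],
   convex_set (calF `&` calG) /\ is_cone (calF `&` calG),
   polar dot4 calF = [set u | let: (lambda, z, eps, delta) := u in
       (perspective F (z, lambda, delta) <= (- eps)%:E)%E]
     /\ polar dot4 calG = [set u | let: (lambda, z, eps, delta) := u in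
       (perspective G ((- z)%R, (- lambda)%R, (- delta)%R)
          <= (- eps)%:E)%E],
   forall (lambda z : H) (eps delta : R),
     fenchel_dual dot4 (indicator calF) (indicator calG)
       (lambda, z, eps, delta) =
     (- indicator (polar dot4 calF) (lambda, z, eps, delta)
      - indicator (polar dot4 calG)
          ((- lambda)%R, (- z)%R, (- eps)%R, (- delta)%R))%E
   & forall (lambda z : H) (eps delta : R),
     ((polar dot4 calF `&` [set - u | u in polar dot4 calG])
        (lambda, z, eps, delta) <->
      (perspective F (z, lambda, delta) <= (- eps)%:E)%E
        /\ (perspective G (z, lambda, delta) <= eps%:E)%E)
     /\ ((polar dot4 calF `&` [set - u | u in polar dot4 calG])
        (lambda, z, eps, delta) <->
      (calF `&` calG) (z, lambda, delta, eps))].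
Proof.
move=> F G space dot4 calF calG.
have dot_symb := symmetric_bilinear_dot dot.
have dot_cont := dot_continuous dot_symb dot_hilbert.
pose dot2 : H * H -> H * H -> R := prod_dot dot dot.
have dot2_symb : symmetric_bilinear dot2 by exact: symmetric_bilinear_prod.
have dot2_cont : forall a, continuous (fun u => dot2 u a).
  exact: prod_dot_continuous.
have dot4_symb : symmetric_bilinear dot4.
  exact: (perspective_cone_symb dot2_symb).
have dot4_cont a : continuous (fun u => dot4 u a).
  exact: (perspective_cone_continuous dot2_cont).
have [f_proper _ _] := f_Gamma0; have [g_proper _ _] := g_Gamma0.
have f'_proper := conjugate_proper dot_symb dot_hilbert f_Gamma0.
have g'_proper := conjugate_proper dot_symb dot_hilbert g_Gamma0.
have f_biconj := fenchel_moreau dot_symb dot_hilbert f_Gamma0.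
have g_biconj := fenchel_moreau dot_symb dot_hilbert g_Gamma0.
(* The conjugates of [F] and [G] once biconjugates are removed: the two summands trade roles, and in
   [G'] the sign moves to [g]. *)
pose F' (p : H * H) : \bar R := (conjugate dot f p.1 + f p.2)%E.
pose G' (p : H * H) : \bar R := (conjugate dot g p.1 + g (- p.2)%R)%E.
have F_proper : Defs.proper F by exact: proper_separable_sum.
have F'_proper : Defs.proper F' by exact: proper_separable_sum.
have G_proper : Defs.proper G.
  exact: proper_separable_sum (proper_opp g'_proper).
have G'_proper : Defs.proper G'.
  exact: proper_separable_sum (proper_opp g_proper).
have FF' : conjugate dot2 F = F'.
  by rewrite /F' /dot2 (conjugate_sum dot dot f_proper f'_proper) f_biconj.
have F'F : conjugate dot2 F' = F.
  by rewrite /F /dot2 (conjugate_sum dot dot f'_proper f_proper) f_biconj.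
have GG' : conjugate dot2 G = G'.
  rewrite /dot2 (conjugate_sum dot dot g_proper (proper_opp g'_proper)).
  by rewrite (conjugate_opp _ dot_symb) g_biconj.
have G'G : conjugate dot2 G' = G.
  rewrite /dot2 (conjugate_sum dot dot g'_proper (proper_opp g_proper)).
  by rewrite (conjugate_opp _ dot_symb) g_biconj.
have F'E w t : perspective F' (w, t) = perspective F (w.2, w.1, t).
  pose swap (p : H * H) := (p.2, p.1).
  rewrite -(@perspective_comp _ _ _ F swap swap) //.
    by congr perspective; apply/funext => p; rewrite /F' /F addeC.
  by case.
have G'E w t : perspective G' (w, t) = perspective G (- w.2, - w.1, t).
  pose oswap (p : H * H) := (- p.2, - p.1).
  rewrite -(@perspective_comp _ _ _ G oswap oswap).
  - by congr perspective; apply/funext => p; rewrite /G' /G /= opprK addeC.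
  - by case=> a b; rewrite /oswap /= !opprK.
  - by move=> [a b] [c d] /=; congr pair; rewrite opprD.
  - by move=> k [a b] /=; congr pair; rewrite scalerN.
(* The bound [- kappa] corresponds to [sigma = -1], and the bound [kappa] in [calG] to
   [sigma = 1]. *)
have calFE : calF = perspective_cone F (-1).
  by apply/seteqP; split=> -[[[x nu] tau] kappa];
     rewrite /calF /perspective_cone /= mulN1r.
have calGE : calG = perspective_cone G 1.
  by apply/seteqP; split=> -[[[x nu] tau] kappa];
     rewrite /calG /perspective_cone /= mul1r.
have polarF : polar dot4 calF = [set u | let: (lambda, z, eps, delta) := u in
    (perspective F (z, lambda, delta) <= (- eps)%:E)%E].
  rewrite calFE (polar_perspective_cone dot2_symb F_proper F'_proper)//;
    last by rewrite mulrNN mulr1.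
  by apply/seteqP; split=> -[[[x nu] tau] kappa];
     rewrite /mkset F'E mulN1r opprK.
have polarG : polar dot4 calG = [set u | let: (lambda, z, eps, delta) := u in
    (perspective G ((- z)%R, (- lambda)%R, (- delta)%R) <= (- eps)%:E)%E].
  rewrite calGE (polar_perspective_cone dot2_symb G_proper G'_proper)//;
    last by rewrite mulr1.
  by apply/seteqP; split=> -[[[x nu] tau] kappa]; rewrite /mkset G'E mul1r.
have [CF calF_polar] : exists C, calF = polar dot4 C.
  rewrite calFE (perspective_cone_bipolar dot2_symb F_proper F'_proper)//.
  by eexists.
have [CG calG_polar] : exists C, calG = polar dot4 C.
  rewrite calGE (perspective_cone_bipolar dot2_symb G_proper G'_proper)//.
  by eexists.
(* The origin gives nonemptiness and, further on, the hypothesis of [conjugate_indicator]. *)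
have [F0 Fclosed Fconvex Fcone] :
    [/\ calF 0, closed calF, convex_set calF & is_cone calF].
  rewrite calF_polar; split; [exact: polar0 | exact: polar_closed |
    exact: polar_convex | exact: polar_cone].
have [G0 Gclosed Gconvex Gcone] :
    [/\ calG 0, closed calG, convex_set calG & is_cone calG].
  rewrite calG_polar; split; [exact: polar0 | exact: polar_closed |
    exact: polar_convex | exact: polar_cone].
have polarFG lambda z eps delta :
    (polar dot4 calF `&` [set - u | u in polar dot4 calG])
      (lambda, z, eps, delta) <->
    (perspective F (z, lambda, delta) <= (- eps)%:E)%E
      /\ (perspective G (z, lambda, delta) <= eps%:E)%E.
  rewrite polarF polarG; split=> -[Fu Gu]; split=> //.
    case: Gu => -[[[x nu] tau] kappa] /= Gu [<- <- <- <-].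
    exact: Gu.
  (* Negating the point cancels all three signs in the description of the polar of [calG]. *)
  exists (- lambda, - z, - eps, - delta); first by rewrite /= !opprK.
  by rewrite -[LHS]/(- - lambda, - - z, - - eps, - - delta) !opprK.
split.
- by split; split=> //; exists 0.
- split; last first.
    by move=> t x t0 [Fx Gx]; split; [exact: Fcone | exact: Gcone].
  move=> x y l; rewrite !in_setI => /andP[Fx Gx] /andP[Fy Gy].
  by rewrite Fconvex ?Gconvex.
- by [].
- move=> lambda z eps delta.
  by rewrite /fenchel_dual !(conjugate_indicator dot4_symb).
(* Unfolded at [(z, lambda, delta, eps)], membership in both cones is the same pair of
   inequalities. *)
- by move=> lambda z eps delta; split; apply: polarFG.
Qed.
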